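(* Let $\mathcal{U},\mathcal{X},\mathcal{Y},\mathcal{W},\mathcal{V}$ be finite alphabets with $|\mathcal{U}|=\alpha$, $|\mathcal{Y}|=\gamma$. Let $P_{Y|X}$ be a discrete memoryless channel (DMC) from $\mathcal{X}$ to $\mathcal{Y}$ (the main channel) and $P_{W|U}$ a DMC from $\mathcal{U}$ to $\mathcal{W}$ (the side-information channel). Let $\rho:\mathcal{U}\times\mathcal{V}\to[0,\infty)$ be a distortion measure with $\rho_{\max}=\max_{u,v}\rho(u,v)<\infty$, let $\phi:\mathcal{X}\to[0,\infty)$ be a transmission cost function and $\Gamma\ge 0$. Let $\ell,d$ be positive integers and $n$ a positive integer divisible by $\ell$, and let $u^n=(u_1,\dots,u_n)\in\mathcal{U}^n$ be a deterministic source sequence. Consider any periodically time-varying finite-state encoder with state set $\mathcal{Z}^{e}$ of size $s_e$, period $\ell$ and arbitrary initial state $z_1^{e}$, operating as $t=i \bmod \ell$, $x_i=f_t(u_i,z_i^{e})$, $z_{i+1}^{e}=g_t(u_i,z_i^{e})$, $i=1,2,\dots$, where the produced channel input sequence satisfies the cost constraint $\frac{1}{n}\sum_{i=1}^n\phi(x_i)\le\Gamma$. The sequence $x_1,x_2,\dots$ is transmitted over the memoryless channel $P_{Y|X}$, producing $Y_1,Y_2,\dots$, and the side information $W_1,W_2,\dots$ is produced from $u_1,u_2,\dots$ by the memoryless channel $P_{W|U}$, independently of the main channel noise. Consider any periodically time-varying finite-state decoder with state set $\mathcal{Z}^{d}$ of size $s_d$, the same period $\ell$, arbitrary initial state $z_1^{d}$,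 and delay $d$, operating as $t=i\bmod \ell$, $V_{i-d}=f'_t(W_i,Y_i,z_i^{d})$ for $i=d+1,d+2,\dots$, and $z_{i+1}^{d}=g'_t(W_i,Y_i,z_i^{d})$ for $i=1,2,\dots$; the symbols $V_{n-d+1},\dots,V_n$ (not yet produced at time $n$) are arbitrary fixed symbols of $\mathcal{V}$. Then there is a quantity $\epsilon_n$, depending only on $n$, $\ell$, $s_e$, the alphabets and the channel $P_{Y|X}$ (and not on $u^n$ or on the particular encoder and decoder), with $\sqrt{n}\,\epsilon_n\to 0$ as $n\to\infty$, such that $$\frac{1}{n}\sum_{i=1}^n\mathbb{E}\{\rho(u_i,V_i)\}\ \ge\ D^{\mathrm{WZ}}_{\hat U^\ell|W^\ell}\left(C(\Gamma)+\frac{\log s_d}{\ell}+\frac{s_e\alpha^\ell\log\gamma}{\sqrt{n}}+\epsilon_n\right)-\frac{\rho_{\max}\, d}{\ell}.$$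
   Context: Logarithms are base 2. Capacity with cost: $C(\Gamma)=\max_{P_X:\ \mathbb{E}\{\phi(X)\}\le\Gamma} I(X;Y)$, where $I(X;Y)$ is computed under $P_X\times P_{Y|X}$. Empirical $\ell$-th order distribution of $u^n$: writing $u^n=(\mathbf{u}_0,\dots,\mathbf{u}_{n/\ell-1})$ with $\mathbf{u}_i=(u_{i\ell+1},\dots,u_{i\ell+\ell})$, let $P_{\hat U^\ell}(a^\ell)=\frac{\ell}{n}\sum_{i=0}^{n/\ell-1}1\{\mathbf{u}_i=a^\ell\}$ for $a^\ell\in\mathcal{U}^\ell$, and let $\hat U^\ell$ be a random vector with this distribution. Let $W^\ell$ be obtained from $\hat U^\ell$ through the product channel $P_{W^\ell|\hat U^\ell}(w^\ell|u^\ell)=\prod_{j=1}^\ell P_{W|U}(w_j|u_j)$. For $u^\ell,v^\ell$, $\rho(u^\ell,v^\ell)=\sum_{j=1}^\ell\rho(u_j,v_j)$. Wyner–Ziv rate–distortion function of this empirical source with real side-information channel: $R^{\mathrm{WZ}}_{\hat U^\ell|W^\ell}(D)=\min \frac{1}{\ell}I(\hat U^\ell;A|W^\ell)$ $(=\min\frac1\ell[I(\hat U^\ell;A)-I(W^\ell;A)])$, the minimum over all conditional distributions $P_{A|\hat U^\ell}$ of an auxiliary random variable $A$ with alphabet $\mathcal{A}$ of size $\alpha^\ell+1$, such that $A\to\hat U^\ell\to W^\ell$ is a Markov chain and $\min_{G:\mathcal{A}\times\mathcal{W}^\ell\to\mathcal{V}^\ell}\mathbb{E}\{\rho(\hat U^\ell,G(A,W^\ell))\}\le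 \ell D$. The Wyner–Ziv distortion–rate function $D^{\mathrm{WZ}}_{\hat U^\ell|W^\ell}(R)$ is its inverse, i.e., the smallest $D$ with $R^{\mathrm{WZ}}_{\hat U^\ell|W^\ell}(D)\le R$. Expectations in $\mathbb{E}\{\rho(u_i,V_i)\}$ are over the randomness of both channels. *)

(* Defs.v *)
From HB Require Import structures.
From mathcomp Require Import all_boot all_order all_algebra.
From mathcomp Require Import all_classical all_reals all_analysis.
Set Implicit Arguments. Unset Strict Implicit. Unset Printing Implicit Defensive.
Import Order.TTheory GRing.Theory Num.Theory.
Local Open Scope classical_set_scope.
Local Open Scope ring_scope.

Section Defs.
Variable R : realType.

Definition log2 (x : R) : R := ln x / ln 2.

Definition stoch (A B : finType) (P : A -> B -> R) : Prop :=
  (forall a b, 0 <= P a b) /\ (forall a, \sum_(b : B) P a b = 1).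

Definition pmf (A : finType) (p : A -> R) : Prop :=
  (forall a, 0 <= p a) /\ \sum_(a : A) p a = 1.

Definition mutinf (X Y : finType) (p : X -> R) (P : X -> Y -> R) : R :=
  \sum_(x : X) \sum_(y : Y)
    (let j := p x * P x y in
     if j == 0 then 0
     else j * log2 (j / (p x * \sum_(x' : X) p x' * P x' y))).

Definition capacity (X Y : finType) (P : X -> Y -> R) (phi : X -> R) (Gam : R)
  : R :=
  sup [set mutinf p P | p in
        [set p : X -> R | pmf p /\ \sum_(x : X) p x * phi x <= Gam]].

Definition rhomax (U V : finType) (rho : U -> V -> R) : R :=
  \big[Num.max/0]_(uv : U * V) rho uv.1 uv.2.

Section WZ.
Variables (U W V : finType) (l : nat).
Local Notation Ul := {ffun 'I_l -> U}.
Local Notation Wl := {ffun 'I_l -> W}.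
Local Notation Vl := {ffun 'I_l -> V}.
Local Notation Aux := 'I_(#|U| ^ l + 1).

Definition emp_dist (n : nat) (u : 'I_n -> U) (a : Ul) : R :=
  l%:R / n%:R *
  #|[set i : 'I_(n %/ l) | [forall j : 'I_l, forall k : 'I_n,
        (val k == i * l + j)%N ==> (u k == a j)]]|%:R.

(* joint law of (U^l, A, W^l): A -> U^l -> W^l Markov, W^l through product channel *)
Definition wz_joint (p : Ul -> R) (Q : Ul -> Aux -> R) (PW : U -> W -> R)
  (uu : Ul) (a : Aux) (w : Wl) : R :=
  p uu * Q uu a * \prod_(j < l) PW (uu j) (w j).

Definition wz_condmi (p : Ul -> R) (Q : Ul -> Aux -> R) (PW : U -> W -> R) : R :=
  let J := wz_joint p Q PW in
  \sum_(uu : Ul) \sum_(a : Aux) \sum_(w : Wl)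
    (let j := J uu a w in
     if j == 0 then 0
     else j * log2 (j * (\sum_(uu' : Ul) \sum_(a' : Aux) J uu' a' w) /
                    ((\sum_(a' : Aux) J uu a' w) * (\sum_(uu' : Ul) J uu' a w)))).

Definition rho_l (rho : U -> V -> R) (uu : Ul) (vv : Vl) : R :=
  \sum_(j < l) rho (uu j) (vv j).

Definition wz_dist (p : Ul -> R) (Q : Ul -> Aux -> R) (PW : U -> W -> R)
  (rho : U -> V -> R) (G : Aux -> Wl -> Vl) : R :=
  \sum_(uu : Ul) \sum_(a : Aux) \sum_(w : Wl)
     wz_joint p Q PW uu a w * rho_l rho uu (G a w).

(* Wyner-Ziv rate-distortion function (extended-real valued, +oo if infeasible);
   "min_G E rho <= l D" over the finite set of maps G is written as existence
   of such a G *)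
Definition RWZ (p : Ul -> R) (PW : U -> W -> R) (rho : U -> V -> R) (D : R)
  : \bar R :=
  ereal_inf [set ((wz_condmi p Q PW) / l%:R)%:E | Q in
     [set Q : Ul -> Aux -> R | stoch Q /\
        exists G : Aux -> Wl -> Vl, wz_dist p Q PW rho G <= l%:R * D]].

Definition DWZ (p : Ul -> R) (PW : U -> W -> R) (rho : U -> V -> R) (Rt : R)
  : \bar R :=
  ereal_inf [set D%:E | D in [set D : R | (RWZ p PW rho D <= Rt%:E)%E]].
End WZ.

Section Coding.
Variables (U X Y W V : finType) (n l : nat).

(* encoder state z^e_{k+1} (k = 0,1,...), 0-indexed position k <-> time k+1 *)
Fixpoint enc_state (Ze : Type) (u : 'I_n -> U) (g : nat -> U -> Ze -> Ze)
  (z1 : Ze) (k : nat) : Ze :=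
  match k with
  | 0 => z1
  | k'.+1 => if @insub _ (fun m => m < n)%N 'I_n k' is Some i
             then g (k'.+1 %% l)%N (u i) (enc_state u g z1 k')
             else enc_state u g z1 k'
  end.

Definition enc_out (Ze : Type) (u : 'I_n -> U) (f : nat -> U -> Ze -> X)
  (g : nat -> U -> Ze -> Ze) (z1 : Ze) (i : 'I_n) : X :=
  f (i.+1 %% l)%N (u i) (enc_state u g z1 i).

Fixpoint dec_state (Zd : Type) (w : 'I_n -> W) (y : 'I_n -> Y)
  (g' : nat -> W -> Y -> Zd -> Zd) (z1 : Zd) (k : nat) : Zd :=
  match k with
  | 0 => z1
  | k'.+1 => if @insub _ (fun m => m < n)%N 'I_n k' is Some i
             then g' (k'.+1 %% l)%N (w i) (y i) (dec_state w y g' z1 k')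
             else dec_state w y g' z1 k'
  end.

(* reconstruction V_{j+1} (0-indexed j): produced at time j+1+d if <= n,
   otherwise the fixed symbol vfix j *)
Definition dec_out (Zd : Type) (d : nat) (w : 'I_n -> W) (y : 'I_n -> Y)
  (f' : nat -> W -> Y -> Zd -> V) (g' : nat -> W -> Y -> Zd -> Zd) (z1 : Zd)
  (vfix : 'I_n -> V) (j : 'I_n) : V :=
  if @insub _ (fun m => m < n)%N 'I_n (j + d)%N is Some m
  then f' (m.+1 %% l)%N (w m) (y m) (dec_state w y g' z1 m)
  else vfix j.

Definition avg_exp_dist (Ze Zd : Type) (PY : X -> Y -> R) (PW : U -> W -> R)
  (rho : U -> V -> R) (d : nat) (u : 'I_n -> U)
  (f : nat -> U -> Ze -> X) (g : nat -> U -> Ze -> Ze) (ze1 : Ze)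
  (f' : nat -> W -> Y -> Zd -> V) (g' : nat -> W -> Y -> Zd -> Zd) (zd1 : Zd)
  (vfix : 'I_n -> V) : R :=
  \sum_(w : {ffun 'I_n -> W}) \sum_(y : {ffun 'I_n -> Y})
    (\prod_(i < n) (PW (u i) (w i) * PY (enc_out u f g ze1 i) (y i))) *
    (n%:R^-1 * \sum_(i < n) rho (u i) (dec_out d w y f' g' zd1 vfix i)).
End Coding.
End Defs.

(* Main.v *)
(** Split time into m = n/l blocks and take as auxiliary variable A the pair (decoder
    state at the start of the block, channel output of the block), for a block drawn
    uniformly. Both components are independent of the side information of the block,
    so A -> U^l -> W^l is a Markov chain; the decoder run from that state reproduces
    all but the last d symbols of the block, which costs at most rhomax * d.
    By Gibbs' inequality I(U^l; A | W^l) is at most the mean divergence of the law of A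
    in a block from any reference law; with (uniform state) x (product of the averaged
    output marginal) this is at most log s_d + l C(Gamma). Hence the bound holds with
    [eps = 0]. Finally the alphabet of A is cut down to |U|^l + 1 letters by a
    Caratheodory argument: with the posteriors fixed, the conditional information, the
    distortion and the law of U^l are linear in the weights of the letters. *)
Require Import Defs.
From HB Require Import structures.
From mathcomp Require Import all_boot all_order all_algebra.
From mathcomp Require Import all_classical all_reals all_analysis.
From mathcomp Require Import ring lra.
Set Implicit Arguments. Unset Strict Implicit. Unset Printing Implicit Defensive.
Import Order.TTheory GRing.Theory Num.Theory numFieldNormedType.Exports.
Local Open Scope ring_scope.

(** * Support reduction *)

(** The vectors indexed by [S], stacked as rows, form a matrix with more rows than columns, so its
    left kernel is nonzero. *)
Lemma conic_dependence (R : realFieldType) (A : finType) (N : nat)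
    (S : {set A}) (v : A -> 'rV[R]_N) :
  (N < #|S|)%N ->
  exists c : A -> R, [/\ exists2 a, a \in S & c a != 0,
    forall a, a \notin S -> c a = 0 & \sum_a c a *: v a = 0].
Proof.
move=> ltNS.
pose M : 'M[R]_(#|S|, N) := \matrix_(i < #|S|) v (enum_val i).
have kM : kermx M != 0.
  rewrite -mxrank_eq0 mxrank_ker subn_eq0 -ltnNge.
  exact: leq_ltn_trans (rank_leq_col M) ltNS.
have /rowV0Pn[b /sub_kermxP bM b0] := kM.
have [i bi] : exists i, b 0 i != 0.
  apply/existsP; rewrite -negb_forall; apply: contra b0 => /forallP b0.
  by apply/eqP/rowP => i; rewrite mxE; apply/eqP.
(* The kernel row is extended by zero outside [S]: the sum has at most one term. *)
pose c a := \sum_(i < #|S| | enum_val i == a) b 0 i.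
have cE j : c (enum_val j) = b 0 j.
  rewrite /c (bigD1 j) //= big1 ?addr0 // => k /andP[/eqP/enum_val_inj ->].
  by rewrite eqxx.
exists c; split.
- by exists (enum_val i); rewrite ?enum_valP ?cE.
- move=> a aS; rewrite /c big1 // => k /eqP ka.
  by move: aS; rewrite -ka enum_valP.
have -> : \sum_a c a *: v a = \sum_(i < #|S|) b 0 i *: v (enum_val i).
  rewrite (partition_big (@enum_val A (mem S)) predT) //=.
  apply: eq_bigr => a _; rewrite /c scaler_suml.
  by apply: eq_bigr => k /eqP ->.
rewrite -[RHS]bM mulmx_sum_row; apply: eq_bigr => k _.
by rewrite rowK.
Qed.

(* A vertex of the polyhedron {t >= 0, \sum t v fixed}: as long as the vectors in
   the support of t are dependent, move along the dependency, in the direction in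
   which h does not increase, until a weight vanishes. *)
Lemma conic_caratheodory (R : realFieldType) (A : finType) (N : nat)
    (v : A -> 'rV[R]_N) (h : A -> R) (L : 'cV[R]_N) (t : A -> R) :
  (forall a, 0 <= t a) ->
  (forall a, t a != 0 -> 0 < (v a *m L) 0 0) ->
  exists t' : A -> R, [/\ forall a, 0 <= t' a,
    (#|[set a | t' a != 0%R]| <= N)%N,
    \sum_a t' a *: v a = \sum_a t a *: v a &
    \sum_a t' a * h a <= \sum_a t a * h a].
Proof.
have [k] := ubnP #|[set a | t a != 0]|; elim: k t => // k IH t.
rewrite ltnS => tk t0 vL.
have [leN|ltN] := leqP #|[set a | t a != 0]| N; first by exists t.
have [c [[a1 a1S ca1] cS cv]] := conic_dependence v ltN.
(* [c] and [- c] are both dependencies, and one of them does not increase [h]. *)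
wlog ch : c ca1 cS cv / \sum_a c a * h a <= 0.
  move=> W; have [|ch] := leP (\sum_a c a * h a) 0; first exact: W.
  apply: (W (fun a => - c a)); rewrite ?oppr_eq0 //.
  - by move=> a /cS ->; rewrite oppr0.
  - by under eq_bigr do rewrite scaleNr; rewrite sumrN cv oppr0.
  - rewrite (eq_bigr (fun a => - (c a * h a))) ?sumrN; first by lra.
    by move=> a _; rewrite mulNr.
(* This is where [L] enters. Were all coefficients nonnegative, pairing the dependency with [L]
   would give a vanishing sum of nonnegative terms, although [a1] contributes a positive one. *)
have [a2 a2n] : exists a, c a < 0.
  have [/existsP //|] := boolP [exists a, c a < 0].
  rewrite negb_exists => /forallP cpos.
  have : \sum_a c a * (v a *m L) 0 0 = 0.
    transitivity (((\sum_a c a *: v a) *m L) 0 0); last first.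
      by rewrite cv mul0mx mxE.
    rewrite mulmx_suml summxE; apply: eq_bigr => a _.
    by rewrite -scalemxAl [RHS]mxE.
  have pos a : 0 <= c a * (v a *m L) 0 0.
    have [aS|aS] := boolP (a \in [set a | t a != 0]); last first.
      by rewrite cS // mul0r.
    apply: mulr_ge0; first by rewrite leNgt.
    by apply/ltW/vL; rewrite inE in aS.
  move=> /eqP; rewrite psumr_eq0 // => /allP /(_ a1).
  rewrite mem_index_enum => /(_ isT) /=; rewrite mulf_eq0 (negPf ca1) /=.
  by rewrite inE in a1S; rewrite gt_eqF // vL.
have [a3 a3n a3min] := @arg_minP _ _ _ a2 (fun a => c a < 0) (fun a => t a / - c a) a2n.
(* The largest step that keeps all weights nonnegative; the weight of [a3] is then exhausted. *)
set tau := t a3 / - c a3 in a3min.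
have tau0 : 0 <= tau by rewrite divr_ge0 // oppr_ge0 ltW.
pose t1 a := t a + tau * c a.
have t1supp a : t a = 0 -> t1 a = 0.
  by move=> ta; rewrite /t1 ta cS ?mulr0 ?addr0 // inE ta eqxx.
have t1v : \sum_a t1 a *: v a = \sum_a t a *: v a.
  under eq_bigr do rewrite scalerDl -scalerA.
  by rewrite big_split /= -scaler_sumr cv scaler0 addr0.
have t1h : \sum_a t1 a * h a <= \sum_a t a * h a.
  under eq_bigr do rewrite mulrDl -mulrA.
  by rewrite big_split /= -mulr_sumr gerDl; apply: mulr_ge0_le0.
have t10 a : 0 <= t1 a.
  rewrite /t1; have [ca|ca] := leP 0 (c a); first by rewrite addr_ge0 // mulr_ge0.
  have := a3min a ca; rewrite ler_pdivlMr ?oppr_gt0 //.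
  lra.
have t1a3 : t1 a3 = 0.
  rewrite /t1 /tau invrN mulrN mulNr -mulrA mulVf ?mulr1 ?subrr //.
  by rewrite lt_eqF.
have a3S : t a3 != 0.
  apply: contraTN a3n => /eqP ta; rewrite -leNgt cS // inE ta eqxx //.
have t1k : (#|[set a | t1 a != 0%R]| < k)%N.
  apply: leq_trans tk; apply: proper_card; apply/properP; split.
    apply/fintype.subsetP => a; rewrite !inE; apply: contra => /eqP ta.
    by apply/eqP/t1supp.
  by exists a3; rewrite !inE ?a3S // t1a3 eqxx.
have [a ta|t2 [t20 t2N t2v t2h]] := IH t1 t1k t10.
  by apply: vL; apply: contra ta => /eqP ta; apply/eqP/t1supp.
exists t2; split=> //; first by rewrite t2v.
exact: le_trans t1h.
Qed.

(** Start from weight 1 on every letter of positive [L]-mass and weight 0 on the others, which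
    contribute nothing to either sum, then list the support of the reduced weights. *)
Lemma caratheodory_reindex (R : realFieldType) (A : finType) (N : nat) (a0 : A)
    (v : A -> 'rV[R]_N) (h : A -> R) (L : 'cV[R]_N) :
  (forall a, 0 < (v a *m L) 0 0 \/ v a = 0 /\ h a = 0) ->
  exists (r : 'I_N -> A) (t : 'I_N -> R), [/\ forall i, 0 <= t i,
    \sum_i t i *: v (r i) = \sum_a v a &
    \sum_i t i * h (r i) <= \sum_a h a].
Proof.
move=> vL; pose t a : R := if 0 < (v a *m L) 0 0 then 1 else 0.
have t0 a : 0 <= t a by rewrite /t; case: ifP.
have tL a : t a != 0 -> 0 < (v a *m L) 0 0.
  by rewrite /t; case: ifP => //; rewrite eqxx.
have [t' [t'0 t'N t'v t'h]] := conic_caratheodory h t0 tL.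
have tE (a : A) : t a = 1 \/ v a = 0 /\ h a = 0.
  by rewrite /t; case: (vL a) => [->|]; [left|right].
set S := [set a | t' a != 0] in t'N.
pose s := enum S.
have sS : size s = #|S| by rewrite /s -cardE.
(* Positions past the end of the support carry the default letter [a0] with weight 0. *)
exists (fun i => nth a0 s i), (fun i => if (i < #|S|)%N then t' (nth a0 s i) else 0).
have reindexE (M : lmodType R) (F : A -> M) : \sum_(i < N)
    (if (i < #|S|)%N then t' (nth a0 s i) else 0) *: F (nth a0 s i)
    = \sum_a t' a *: F a.
  rewrite (eq_bigr (fun i : 'I_N => if (i < #|S|)%N then
      t' (nth a0 s i) *: F (nth a0 s i) else 0)); last first.
    by move=> i _; case: ifP => // _; rewrite scale0r.
  rewrite -big_mkcond /= -(big_ord_widen N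
    (fun i => t' (nth a0 s i) *: F (nth a0 s i)) t'N).
  rewrite -sS -(big_mkord predT (fun i => t' (nth a0 s i) *: F (nth a0 s i))).
  rewrite -(big_nth a0 predT (fun a => t' a *: F a)) /s big_enum /=.
  rewrite [RHS](bigID (mem S)) /= [X in _ = _ + X]big1 ?addr0 // => a.
  by rewrite inE negbK => /eqP ->; rewrite scale0r.
split.
- by move=> i; case: ifP.
- rewrite reindexE t'v; apply: eq_bigr => a _.
  by case: (tE a) => [->|[-> _]]; rewrite ?scale1r ?scaler0.
rewrite (reindexE R^o h); apply: le_trans t'h _; apply: ler_sum => a _.
by case: (tE a) => [->|[_ ->]]; rewrite ?mul1r ?mulr0.
Qed.

(** * Conditional mutual information *)

(** The formula of [wz_condmi] over arbitrary alphabets, so that it applies to A both before and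
    after its alphabet is cut down. *)
Definition condmi (R : realType) (T A S : finType) (J : T -> A -> S -> R) : R :=
  \sum_(u : T) \sum_(a : A) \sum_(w : S)
    (let j := J u a w in
     if j == 0 then 0
     else j * log2 (j * (\sum_(u' : T) \sum_(a' : A) J u' a' w) /
                    ((\sum_(a' : A) J u a' w) * (\sum_(u' : T) J u' a w)))).

(** Each letter is the vector of its column of [q] and its distortion share [delta a], hence
    dimension [#|T| + 1]. The columns are unnormalized, so fixing their sum also fixes the total
    mass. *)
Lemma aux_reduction (R : realType) (T A S : finType) (N : nat) (a0 : A)
    (q : T -> A -> R) (k : T -> S -> R) (delta : A -> R) :
  N = (#|T| + 1)%N -> (forall u a, 0 <= q u a) ->
  (forall a, (forall u, q u a = 0) -> delta a = 0) ->
  exists (r : 'I_N -> A) (t : 'I_N -> R), [/\ forall i, 0 <= t i,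
    forall u, \sum_i t i * q u (r i) = \sum_a q u a,
    \sum_i t i * delta (r i) = \sum_a delta a &
    condmi (fun u i w => t i * q u (r i) * k u w) <=
      condmi (fun u a w => q u a * k u w)].
Proof.
move=> -> q0 delta0.
pose J u a w := q u a * k u w.
pose h a := \sum_u \sum_w (if J u a w == 0 then 0
     else J u a w * log2 (J u a w * (\sum_u' \sum_a' J u' a' w) /
                    ((\sum_a' J u a' w) * (\sum_u' J u' a w)))).
pose v a : 'rV[R]_(#|T| + 1) :=
  row_mx (\row_i q (enum_val i) a) (const_mx (delta a)).
(* Pairing with [L] gives the mass of a letter; a letter of mass 0 has zero column, zero distortion
   and zero information. *)
pose L : 'cV[R]_(#|T| + 1) := col_mx (const_mx 1) (const_mx 0).
have vL a : (v a *m L) 0 0 = \sum_u q u a.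
  rewrite mul_row_col mxE [X in _ + X]mxE [X in _ + X]big1 ?addr0; last first.
    by move=> i _; rewrite !mxE mulr0.
  rewrite mxE [RHS](reindex _ (onW_bij _ (@enum_val_bij T))) /=.
  by apply: eq_bigr => i _; rewrite !mxE mulr1.
have [a|r [t [t0 tv th]]] := @caratheodory_reindex R A (#|T| + 1) a0 v h L.
  rewrite vL lt0r sumr_ge0 ?andbT //.
  have [/eqP|] := eqVneq (\sum_u q u a) 0; last by left.
  rewrite psumr_eq0 // => /allP qa; right.
  have {}qa u : q u a = 0 by apply/eqP/qa; rewrite mem_index_enum.
  split.
    rewrite /v delta0 //.
    by apply/rowP => i; rewrite !mxE; case: splitP => j; rewrite !mxE ?qa.
  by apply: big1 => u _; apply: big1 => w _; rewrite /J qa mul0r eqxx.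
have tvE i : \sum_j t j * v (r j) 0 i = \sum_a v a 0 i.
  have := congr1 (fun m : 'rV_(#|T| + 1) => m 0 i) tv; rewrite !summxE => <-.
  by apply: eq_bigr => j _; rewrite [RHS]mxE.
have tq u : \sum_i t i * q u (r i) = \sum_a q u a.
  have := tvE (lshift 1 (enum_rank u)).
  under eq_bigr do rewrite row_mxEl mxE enum_rankK.
  by under [X in _ = X -> _]eq_bigr do rewrite row_mxEl mxE enum_rankK.
exists r, t; split=> //.
  have := tvE (rshift #|T| ord0).
  under eq_bigr do rewrite row_mxEr mxE.
  by under [X in _ = X -> _]eq_bigr do rewrite row_mxEr mxE.
(* Linearity in the weights: the (U, W) marginals do not change, while the joint law and its (A, W)
   marginal both scale by [t i], which cancels inside the logarithm. *)
suff <- : \sum_i t i * h (r i) = condmi (fun u i w => t i * q u (r i) * k u w).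
  by rewrite /condmi exchange_big.
have Jw w : \sum_u \sum_i t i * q u (r i) * k u w = \sum_u \sum_a J u a w.
  by apply: eq_bigr => u _; rewrite /J -!mulr_suml tq.
have Juw u w : \sum_i t i * q u (r i) * k u w = \sum_a J u a w.
  by rewrite /J -!mulr_suml tq.
have Jiw i w : \sum_u t i * q u (r i) * k u w = t i * \sum_u J u (r i) w.
  by rewrite mulr_sumr; apply: eq_bigr => u _; rewrite /J mulrA.
rewrite [RHS]exchange_big /=; apply: eq_bigr => i _.
rewrite mulr_sumr; apply: eq_bigr => u _.
rewrite mulr_sumr; apply: eq_bigr => w _.
have -> : t i * q u (r i) * k u w = t i * J u (r i) w by rewrite /J mulrA.
rewrite Jw Juw Jiw [t i * _ == 0]mulf_eq0.
have [ti|ti] /= := eqVneq (t i) 0; first by rewrite ti mul0r.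
case: ifP => _; first by rewrite mulr0.
rewrite [LHS]mulrA; congr (_ * log2 _).
by rewrite -[X in _ = X / _]mulrA [X in _ = _ / X]mulrCA -[RHS]mulf_div divff // mul1r.
Qed.

Lemma log2_le (R : realType) (x : R) : 0 < x -> log2 x <= (x - 1) / ln 2.
Proof.
move=> x0; rewrite /log2 ler_pM2r ?invr_gt0 ?ln_gt0 ?ltr1n //.
have := @le_ln1Dx R (x - 1); rewrite addrCA subrr addr0; apply.
by lra.
Qed.

Lemma log2M (R : realType) (x y : R) :
  0 < x -> 0 < y -> log2 (x * y) = log2 x + log2 y.
Proof. by move=> x0 y0; rewrite /log2 lnM ?posrE // mulrDl. Qed.

Lemma log2V (R : realType) (x : R) : 0 < x -> log2 x^-1 = - log2 x.
Proof. by move=> x0; rewrite /log2 lnV ?posrE // mulNr. Qed.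

Lemma log2_ge0 (R : realType) (x : R) : 1 <= x -> 0 <= log2 x.
Proof. by move=> x1; rewrite /log2 divr_ge0 ?ln_ge0 // ler1n. Qed.

Lemma sum_fiber (R : nzRingType) (B T : finType) (ub : B -> T)
    (g : B -> R) (F : T -> R) :
  \sum_u (\sum_(j | ub j == u) g j) * F u = \sum_j g j * F (ub j).
Proof.
rewrite [RHS](partition_big ub predT) //=; apply: eq_bigr => u _.
by rewrite mulr_suml; apply: eq_bigr => j /eqP ->.
Qed.

(* Gibbs' inequality, comparing the law of (block, A, W) with the one in which
   A given W is replaced by r and the block is drawn from its posterior. *)
Lemma condmi_mixture_le (R : realType) (B T A S : finType) (pi : B -> R)
    (ub : B -> T) (Q : B -> A -> R) (k : T -> S -> R) (r : A -> R) :
  Defs.pmf pi -> stoch Q -> stoch k ->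
  (forall a, 0 <= r a) -> \sum_a r a <= 1 ->
  (forall j a, r a = 0 -> Q j a = 0) ->
  condmi (fun u a w => (\sum_(j | ub j == u) pi j * Q j a) * k u w) <=
    \sum_j pi j * \sum_a Q j a * log2 (Q j a / r a).
Proof.
move=> [pi0 pi1] [Q0 Q1] [k0 k1] r0 r1 rQ.
pose q u a := \sum_(j | ub j == u) pi j * Q j a.
have q0 u a : 0 <= q u a by apply: sumr_ge0 => j _; rewrite mulr_ge0.
pose J u a w := q u a * k u w.
have J0 u a w : 0 <= J u a w by rewrite mulr_ge0.
pose Jw w := \sum_u \sum_a J u a w.
pose Juw u w := \sum_a J u a w.
pose Jaw a w := \sum_u J u a w.
have Juw0 u w : 0 <= Juw u w by apply: sumr_ge0 => a _.
have Jaw0 a w : 0 <= Jaw a w by apply: sumr_ge0 => u _.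
have Jw0 w : 0 <= Jw w by apply: sumr_ge0 => u _; apply: Juw0.
(* [g] is the argument of the logarithm in [condmi]; [K] below is the joint law of block index, A
   and W. *)
pose g u a w := J u a w * Jw w / (Juw u w * Jaw a w).
have g0 u a w : 0 <= g u a w by rewrite divr_ge0 ?mulr_ge0.
pose K j a w := pi j * Q j a * k (ub j) w.
have K0 j a w : 0 <= K j a w by rewrite !mulr_ge0.
have KJ j a w : K j a w <= J (ub j) a w.
  rewrite ler_wpM2r // /q (bigD1 j) //= lerDl.
  by apply: sumr_ge0 => i _; rewrite mulr_ge0.
have JJuw u a w : J u a w <= Juw u w.
  by rewrite /Juw (bigD1 a) //= lerDl sumr_ge0.
have JJaw u a w : J u a w <= Jaw a w.
  by rewrite /Jaw (bigD1 u) //= lerDl sumr_ge0.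
have JuwJw u w : Juw u w <= Jw w.
  by rewrite /Jw (bigD1 u) //= lerDl sumr_ge0 // => u' _; apply: Juw0.
have JuwE u w : Juw u w = (\sum_(j | ub j == u) pi j) * k u w.
  rewrite /Juw -mulr_suml exchange_big /=; congr (_ * _).
  by apply: eq_bigr => j _; rewrite -mulr_sumr Q1 mulr1.
have condmiE : condmi J = \sum_j \sum_a \sum_w K j a w * log2 (g (ub j) a w).
  transitivity (\sum_a \sum_w \sum_u J u a w * log2 (g u a w)).
    rewrite /condmi exchange_big /=; apply: eq_bigr => a _.
    rewrite exchange_big /=; apply: eq_bigr => w _; apply: eq_bigr => u _.
    by case: eqVneq => [->|//]; rewrite mul0r.
  rewrite [RHS]exchange_big /=; apply: eq_bigr => a _.
  rewrite [RHS]exchange_big /=; apply: eq_bigr => w _.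
  under eq_bigr do rewrite /J /q -mulrA.
  rewrite (sum_fiber _ _ (fun u => k u w * log2 (g u a w))).
  by apply: eq_bigr => j _; rewrite mulrA.
(* The comparison measure: summed over the blocks with value u it is
   [r a * Jw w * J u a w / Jaw a w], up to zero denominators. *)
pose b j a w := pi j * k (ub j) w * r a * g (ub j) a w.
have sumb : \sum_j \sum_a \sum_w b j a w <= 1.
  have -> : \sum_j \sum_a \sum_w b j a w =
      \sum_a \sum_w r a * \sum_u Juw u w * g u a w.
    rewrite exchange_big /=; apply: eq_bigr => a _.
    rewrite exchange_big /=; apply: eq_bigr => w _.
    under [in RHS]eq_bigr do rewrite JuwE -mulrA.
    rewrite (sum_fiber _ _ (fun u => k u w * g u a w)) mulr_sumr.
    by apply: eq_bigr => j _; rewrite /b; ring.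
  (* Only an inequality: as [x / 0 = 0], cells with a vanishing denominator lose mass. *)
  apply: (@le_trans _ _ (\sum_a \sum_w r a * Jw w)).
    apply: ler_sum => a _; apply: ler_sum => w _; apply: ler_wpM2l => //.
    apply: (@le_trans _ _ (\sum_u J u a w * (Jw w / Jaw a w))).
      apply: ler_sum => u _; rewrite /g.
      have [z|nz] := eqVneq (Juw u w) 0.
        by rewrite z !mul0r mulr_ge0 // divr_ge0.
      rewrite invfM (_ : Juw u w * _ =
        J u a w * (Jw w / Jaw a w) * (Juw u w / Juw u w)); last by ring.
      by rewrite divff // mulr1.
    rewrite -mulr_suml -/(Jaw a w) mulrCA.
    by have [->|nz] := eqVneq (Jaw a w) 0; rewrite ?mul0r ?mulr0 // divff ?mulr1.
  have JwE : \sum_w Jw w = 1.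
    transitivity (\sum_w \sum_u Juw u w) => //.
    rewrite exchange_big /= -pi1 [RHS](partition_big ub predT) //=.
    apply: eq_bigr => u _; under eq_bigr do rewrite JuwE.
    by rewrite -mulr_sumr k1 mulr1.
  by under eq_bigr do rewrite -mulr_sumr JwE mulr1.
have sumK : \sum_j \sum_a \sum_w K j a w = 1.
  rewrite -pi1; apply: eq_bigr => j _.
  under eq_bigr do rewrite -mulr_sumr k1 mulr1.
  by rewrite -mulr_sumr Q1 mulr1.
rewrite -/J -[condmi _]/(condmi J) condmiE.
(* Since [b / K = g / (Q / r)], the bound [log2 x <= (x - 1) / ln 2] at [x = b / K] gives this
   termwise; the correction sums to at most 0 because [b] has mass at most 1 and [K] has mass 1. *)
apply: (@le_trans _ _ (\sum_j \sum_a \sum_w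
    (K j a w * log2 (Q j a / r a) + (b j a w - K j a w) / ln 2))).
  apply: ler_sum => j _; apply: ler_sum => a _; apply: ler_sum => w _.
  have ln2 : 0 < ln 2 :> R by rewrite ln_gt0 // ltr1n.
  (* Where [K] vanishes [b] may still be positive, and the claim is just [0 <= b / ln 2]. *)
  have [Kz|Kn] := eqVneq (K j a w) 0.
    rewrite Kz !mul0r add0r subr0; apply: divr_ge0; last exact: ltW.
    apply: mulr_ge0; last exact: g0.
    by rewrite !mulr_ge0.
  have Kp : 0 < K j a w by rewrite lt0r Kn K0.
  have Jp := lt_le_trans Kp (KJ j a w).
  have Juwp := lt_le_trans Jp (JJuw _ _ _).
  have Jawp := lt_le_trans Jp (JJaw _ _ _).
  have Jwp := lt_le_trans Juwp (JuwJw _ _).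
  have gp : 0 < g (ub j) a w by apply: divr_gt0; exact: mulr_gt0.
  have /andP[/andP[pij Qj] kj] : (pi j != 0) && (Q j a != 0) && (k (ub j) w != 0).
    by move: Kn; rewrite /K !mulf_eq0 !negb_or.
  have Qp : 0 < Q j a by rewrite lt0r Qj Q0.
  have rp : 0 < r a by rewrite lt0r r0 andbT; apply: contra_neq Qj => /rQ.
  have bK : b j a w / K j a w = g (ub j) a w * (Q j a / r a)^-1.
    by rewrite /b /K; field; rewrite pij Qj kj gt_eqF.
  have Qrp : 0 < Q j a / r a by exact: divr_gt0.
  have bKp : 0 < b j a w / K j a w by rewrite bK mulr_gt0 ?invr_gt0.
  have := log2_le bKp; rewrite {1}bK log2M ?invr_gt0 // log2V //.
  move=> /(ler_wpM2l (ltW Kp)).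
  have -> : K j a w * ((b j a w / K j a w - 1) / ln 2)
    = (b j a w - K j a w) / ln 2 by field; rewrite Kn gt_eqF.
  by rewrite mulrBr lerBlDl.
have sumbK : \sum_j \sum_a \sum_w (b j a w - K j a w) / ln 2 =
    (\sum_j \sum_a \sum_w b j a w - \sum_j \sum_a \sum_w K j a w) / ln 2.
  rewrite -sumrB mulr_suml; apply: eq_bigr => j _.
  rewrite -sumrB mulr_suml; apply: eq_bigr => a _.
  by rewrite -sumrB mulr_suml.
under eq_bigr do under eq_bigr do rewrite big_split /=.
under eq_bigr do rewrite big_split /=.
rewrite big_split /= sumbK sumK.
rewrite -[leRHS]addr0; apply: lerD.
  rewrite le_eqVlt; apply/orP; left; apply/eqP; apply: eq_bigr => j _.
  rewrite mulr_sumr; apply: eq_bigr => a _.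
  by rewrite -mulr_suml -mulr_sumr k1 mulr1 mulrA.
by rewrite mulr_le0_ge0 ?subr_le0 // invr_ge0 ln_ge0 // ler1n.
Qed.

(** [capacity] is a [sup], which dominates its set only once boundedness is known. Each summand is
    at most [1 / ln 2]: by [log2_le] it suffices that [j * (j / (p x * m)) = P x y * (j / m) <=
    1]. *)
Lemma has_ubound_mutinf (R : realType) (X Y : finType) (P : X -> Y -> R)
    (phi : X -> R) (Gam : R) :
  stoch P ->
  has_ubound [set mutinf p P | p in
    [set p : X -> R | Defs.pmf p /\ \sum_(x : X) p x * phi x <= Gam]]%classic.
Proof.
move=> [P0 P1].
have ln2 : 0 < ln 2 :> R by rewrite ln_gt0 // ltr1n.
exists (\sum_(x : X) \sum_(y : Y) (ln 2)^-1) => _ [p [[p0 p1] _] <-].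
apply: ler_sum => x _; apply: ler_sum => y _ /=.
case: eqVneq => [_|n0]; first by rewrite invr_ge0 ltW.
set j := p x * P x y; set m := \sum_x' _.
have j0 : 0 < j by rewrite lt0r n0 mulr_ge0.
have jm : j <= m.
  by rewrite /m (bigD1 x) //= lerDl sumr_ge0 // => i _; rewrite mulr_ge0.
have m0 := lt_le_trans j0 jm.
have px : 0 < p x by rewrite lt0r p0 andbT; apply: contra_neq n0 => ->; rewrite mul0r.
have jm1 : j / m <= 1 by rewrite ler_pdivrMr // mul1r.
have Pxy : P x y <= 1.
  by rewrite -(P1 x) (bigD1 y) //= lerDl sumr_ge0.
apply: (@le_trans _ _ (j * ((j / (p x * m) - 1) / ln 2))).
  by rewrite ler_pM2l // log2_le // divr_gt0 // mulr_gt0.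
rewrite mulrA ler_pdivrMr // mulVf ?gt_eqF //.
apply: (@le_trans _ _ (j * (j / (p x * m)))).
  by rewrite ler_pM2l // gerBl.
have -> : j * (j / (p x * m)) = P x y * (j / m).
  by rewrite /j; field; rewrite !gt_eqF.
by rewrite -[leRHS]mulr1 ler_pM // divr_ge0 ?ltW.
Qed.

(* With the uniform law on the n channel inputs, mutual information is the mean
   divergence from the output marginal. *)
Lemma mean_divergence_le_capacity (R : realType) (X Y I : finType)
    (P : X -> Y -> R) (phi : X -> R) (Gam : R) (x : I -> X) :
  stoch P -> (0 < #|I|)%N ->
  #|I|%:R^-1 * \sum_i phi (x i) <= Gam ->
  #|I|%:R^-1 * \sum_i \sum_y P (x i) y *
     log2 (P (x i) y / (#|I|%:R^-1 * \sum_i P (x i) y)) <= capacity P phi Gam.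
Proof.
move=> sP I0 cost; have [P0 P1] := sP.
have nI : 0 < #|I|%:R :> R by rewrite ltr0n.
(* The empirical law of the inputs, admissible by the cost hypothesis. *)
pose p x0 : R := \sum_(i | x i == x0) #|I|%:R^-1.
have pF (F : X -> R) : \sum_x0 p x0 * F x0 = #|I|%:R^-1 * \sum_i F (x i).
  by rewrite sum_fiber mulr_sumr.
have pP : Defs.pmf p.
  split=> [x0|]; first by apply: sumr_ge0 => i _; rewrite invr_ge0 ltW.
  under eq_bigr do rewrite -[p _]mulr1.
  by rewrite pF sumr_const cardT -cardE mulVf // gt_eqF.
apply: (@le_trans _ _ (mutinf p P)); last first.
  by apply: ub_le_sup; [exact: has_ubound_mutinf | exists p => //=; rewrite pF].
rewrite -(pF (fun x0 => \sum_y P x0 y *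
     log2 (P x0 y / (#|I|%:R^-1 * \sum_i P (x i) y)))).
apply: ler_sum => x0 _; rewrite mulr_sumr; apply: ler_sum => y _ /=.
rewrite pF; case: eqVneq => [jz|]; first by rewrite mulrA jz mul0r.
rewrite mulf_eq0 negb_or => /andP[px0 Pxy].
by rewrite mulrA -mulf_div divff // mul1r.
Qed.

(** * Product laws and blocks *)

Lemma sum_ffun_pair (R : nzRingType) (I C D : finType)
    (F : {ffun I -> C} -> {ffun I -> D} -> R) :
  \sum_w \sum_y F w y =
    \sum_(s : {ffun I -> C * D}) F [ffun i => (s i).1] [ffun i => (s i).2].
Proof.
rewrite pair_big /=.
rewrite (reindex (fun s : {ffun I -> C * D} =>
    ([ffun i => (s i).1], [ffun i => (s i).2]))) //=.
exists (fun p : {ffun I -> C} * {ffun I -> D} => [ffun i => (p.1 i, p.2 i)]).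
  by move=> s _; apply/ffunP => i; rewrite !ffunE; case: (s i).
by move=> [w y] _; congr (_, _); apply/ffunP => i; rewrite !ffunE.
Qed.

Section ProductLaw.
Variables (R : realFieldType) (I C : finType) (kappa : I -> C -> R).
Hypothesis kappa1 : forall i, \sum_c kappa i c = 1.

Let mu (s : {ffun I -> C}) : R := \prod_i kappa i (s i).

Lemma product_law_total : \sum_(s : {ffun I -> C}) \prod_i kappa i (s i) = 1.
Proof. by rewrite -bigA_distr_bigA big1. Qed.

(** Group the factors [phi k] by the coordinate [e k] they read. By injectivity a coordinate carries
    at most one factor; those without any integrate to 1. *)
Lemma product_law_prod (K : finType) (e : K -> I) (phi : K -> C -> R) :
  injective e ->
  \sum_(s : {ffun I -> C}) (\prod_i kappa i (s i)) * \prod_k phi k (s (e k)) =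
    \prod_k \sum_c kappa (e k) c * phi k c.
Proof.
move=> einj.
transitivity (\sum_(s : {ffun I -> C})
    \prod_i (kappa i (s i) * \prod_(k | e k == i) phi k (s i))).
  apply: eq_bigr => s _; rewrite big_split /=; congr (_ * _).
  rewrite (partition_big e predT) //=; apply: eq_bigr => i _.
  by apply: eq_bigr => k /eqP ->.
rewrite -(bigA_distr_bigA (fun i c => kappa i c * \prod_(k | e k == i) phi k c)).
rewrite [RHS](partition_big e predT) //=; apply: eq_bigr => i _.
have [/existsP[k /eqP <-]|ni] := boolP [exists k, e k == i].
  have ek k' : (e k' == e k) = (k' == k) by rewrite (inj_eq einj).
  rewrite [RHS](big_pred1 k) //; apply: eq_bigr => c _.
  by rewrite (big_pred1 k).
have ne k : (e k == i) = false.
  by apply: contraNF ni => ki; apply/existsP; exists k.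
rewrite [RHS]big_pred0 //; under eq_bigr do rewrite big_pred0 // mulr1.
exact: kappa1.
Qed.

(** Expand [F] over the point indicators of [b]; each is a product over coordinates, covered by
    [product_law_prod]. *)
Lemma product_law_marginal (K : finType) (e : K -> I)
    (F : {ffun K -> C} -> R) :
  injective e ->
  \sum_(s : {ffun I -> C}) (\prod_i kappa i (s i)) * F [ffun k => s (e k)] =
    \sum_(b : {ffun K -> C}) (\prod_k kappa (e k) (b k)) * F b.
Proof.
move=> einj.
transitivity (\sum_(s : {ffun I -> C}) \sum_(b : {ffun K -> C})
   (\prod_i kappa i (s i)) * (\prod_k (s (e k) == b k)%:R) * F b).
  apply: eq_bigr => s _.
  rewrite (bigD1 [ffun k => s (e k)]) //= [X in _ + X]big1 ?addr0 => [|b nb].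
    by rewrite [X in _ * X * _]big1 ?mulr1 // => k _; rewrite ffunE eqxx.
  suff [k kb] : exists k, s (e k) != b k.
    by rewrite (bigD1 k) //= (negPf kb) mul0r mulr0 mul0r.
  apply/existsP; rewrite -negb_forall; apply: contra nb => /forallP sb.
  by apply/eqP/ffunP => k; rewrite ffunE; apply/esym/eqP.
rewrite exchange_big /=; apply: eq_bigr => b _; rewrite -mulr_suml; congr (_ * _).
rewrite (product_law_prod (fun k c => (c == b k)%:R)) //.
apply: eq_bigr => k _; rewrite (bigD1 (b k)) //= eqxx mulr1 big1 ?addr0 //.
by move=> c /negPf ->; rewrite mulr0.
Qed.

Lemma product_law_proj (i : I) (F : C -> R) :
  \sum_(s : {ffun I -> C}) (\prod_i kappa i (s i)) * F (s i) = \sum_c kappa i c * F c.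
Proof.
have := @product_law_prod 'I_1 (fun=> i) (fun=> F).
rewrite big_ord1 => <- => [|k k' _]; last by rewrite !ord1.
by apply: eq_bigr => s _; rewrite big_ord1.
Qed.

(* Exchanging the coordinates in B between two independent copies preserves their
   law; it turns f(s) g(s') into f(s) g(s). *)
Lemma product_law_indep (B : {set I}) (f g : {ffun I -> C} -> R) :
  (forall s s' : {ffun I -> C}, (forall i, i \notin B -> s i = s' i) -> f s = f s') ->
  (forall s s' : {ffun I -> C}, (forall i, i \in B -> s i = s' i) -> g s = g s') ->
  \sum_s mu s * (f s * g s) = (\sum_s mu s * f s) * (\sum_s mu s * g s).
Proof.
move=> fB gB.
pose mix (a b : {ffun I -> C}) := [ffun i => if i \in B then b i else a i].
have mixK (a b : {ffun I -> C}) : mix (mix a b) (mix b a) = a.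
  by apply/ffunP => i; rewrite !ffunE; case: (i \in B).
rewrite big_distrlr pair_big /=.
rewrite (reindex_inj (h := fun p => (mix p.1 p.2, mix p.2 p.1))) /=; last first.
  apply: (can_inj (g := fun p => (mix p.1 p.2, mix p.2 p.1))).
  by move=> [a b] /=; rewrite !mixK.
transitivity (\sum_(p : {ffun I -> C} * {ffun I -> C})
    mu p.1 * (f p.1 * g p.1) * mu p.2).
  rewrite -(pair_bigA _ (fun a b => mu a * (f a * g a) * mu b)) /=.
  by apply: eq_bigr => a _; rewrite -mulr_sumr product_law_total mulr1.
apply: eq_bigr => -[a b] _ /=.
have -> : f (mix a b) = f a by apply: fB => i /negPf iB; rewrite ffunE iB.
have -> : g (mix b a) = g a by apply: gB => i iB; rewrite ffunE iB.
have muE : mu (mix a b) * mu (mix b a) = mu a * mu b.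
  rewrite /mu -!big_split /=; apply: eq_bigr => i _; rewrite !ffunE.
  by case: (i \in B) => //; rewrite mulrC.
by rewrite mulrACA muE; ring.
Qed.

End ProductLaw.

(** * Cutting time into m blocks of length l *)

Lemma block_index_subproof (m l : nat) (j : 'I_m) (k : 'I_l) :
  (j * l + k < m * l)%N.
Proof.
apply: (@leq_trans (j.+1 * l)); first by rewrite mulSn addnC ltn_add2r.
by rewrite leq_mul2r ltn_ord orbT.
Qed.

Definition block_index (m l : nat) (j : 'I_m) (k : 'I_l) : 'I_(m * l) :=
  Ordinal (block_index_subproof j k).

Lemma block_index_inj (m l : nat) (j j' : 'I_m) (k k' : 'I_l) :
  block_index j k = block_index j' k' -> j = j' /\ k = k'.
Proof.
move=> /(congr1 val) /= E.
have l0 : (0 < l)%N by apply: leq_trans (ltn_ord k).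
split; apply/val_inj => /=.
  by have := congr1 (divn^~ l) E; rewrite !divnMDl // !divn_small // !addn0.
by have := congr1 (modn^~ l) E; rewrite !modnMDl !modn_small.
Qed.

Lemma sum_blocks (R : nzRingType) (m l : nat) (F : 'I_(m * l) -> R) :
  \sum_i F i = \sum_(j < m) \sum_(k < l) F (block_index j k).
Proof.
rewrite pair_big /=.
rewrite (reindex (fun p : 'I_m * 'I_l => block_index p.1 p.2)) //=.
apply: onW_bij; apply: inj_card_bij => [[j k] [j' k']|].
  by move=> /block_index_inj /= [-> ->].
by rewrite card_prod !card_ord.
Qed.

(** * The decoder run on a single block *)

Section BlockDecoder.
Variables (W Y V Z : finType) (m l d : nat).
Variables (f' : nat -> W -> Y -> Z -> V) (g' : nat -> W -> Y -> Z -> Z).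

Lemma eq_dec_state (n : nat) (w w2 : 'I_n -> W) (y y2 : 'I_n -> Y) (z : Z) k :
  (forall i : 'I_n, (i < k)%N -> w i = w2 i /\ y i = y2 i) ->
  dec_state l w y g' z k = dec_state l w2 y2 g' z k.
Proof.
elim: k => //= k IH wy; rewrite IH => [|i ik]; last by apply: wy; exact: ltnW.
case: insubP => // i _ ik; have [|-> ->] := wy i => //.
by rewrite ltnS ik.
Qed.

(** The decoder has period [l], so shifting time by [j * l] leaves its rules unchanged and it can be
    restarted from the state at the start of the block. *)
Lemma dec_state_block (w : 'I_(m * l) -> W) (y : 'I_(m * l) -> Y) (z : Z)
    (j : 'I_m) k : (k <= l)%N ->
  dec_state l w y g' z (j * l + k) =
  dec_state l (fun k => w (block_index j k)) (fun k => y (block_index j k)) g'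
    (dec_state l w y g' z (j * l)) k.
Proof.
elim: k => [|k IH] kl; first by rewrite addn0.
rewrite addnS /= IH ?(ltnW kl) // -addnS modnMDl.
have kn := block_index_subproof j (Ordinal kl).
rewrite (insubT (fun i => i < m * l)%N kn) (insubT (fun i => i < l)%N kl) /=.
by congr (g' _ (w _) (y _) _); apply/val_inj.
Qed.

(** For [k + d < l] the delayed symbol is emitted inside the same block, so neither filler [v] nor
    [v2] is read. *)
Lemma dec_out_block (w : 'I_(m * l) -> W) (y : 'I_(m * l) -> Y) (z : Z)
    (v : 'I_(m * l) -> V) (v2 : 'I_l -> V) (j : 'I_m) (k : 'I_l) :
  (k + d < l)%N ->
  dec_out l d w y f' g' z v (block_index j k) =
  dec_out l d (fun k => w (block_index j k)) (fun k => y (block_index j k))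
    f' g' (dec_state l w y g' z (j * l)) v2 k.
Proof.
move=> kd; rewrite /dec_out /= -addnA.
have kn := block_index_subproof j (Ordinal kd).
rewrite (insubT (fun i => i < m * l)%N kn) (insubT (fun i => i < l)%N kd) /=.
rewrite dec_state_block ?(ltnW kd) // -addnS modnMDl.
by congr (f' _ (w _) (y _) _); apply/val_inj.
Qed.

Lemma eq_dec_out (n : nat) (w w2 : 'I_n -> W) (y y2 : 'I_n -> Y) (z : Z)
    (v : 'I_n -> V) (i : 'I_n) :
  w =1 w2 -> y =1 y2 ->
  dec_out l d w y f' g' z v i = dec_out l d w2 y2 f' g' z v i.
Proof.
move=> ww yy; rewrite /dec_out; case: insubP => // i' _ _.
by rewrite ww yy (@eq_dec_state _ w w2 y y2).
Qed.

End BlockDecoder.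

Lemma log2_prod (R : realType) (I : finType) (c : I -> R) :
  (forall i, 0 < c i) -> log2 (\prod_i c i) = \sum_i log2 (c i).
Proof.
move=> c0.
suff [//] : log2 (\prod_i c i) = \sum_i log2 (c i) /\ 0 < \prod_i c i.
elim/big_rec2: _ => [|i x y _ [<- y0]]; first by rewrite /log2 ln1 mul0r.
by rewrite log2M // mulr_gt0.
Qed.

Lemma ler_log2 (R : realType) (x y : R) : 0 < x -> x <= y -> log2 x <= log2 y.
Proof.
move=> x0 xy; rewrite /log2 ler_pM2r ?invr_gt0 ?ln_gt0 ?ltr1n //.
by rewrite ler_ln // posrE // (lt_le_trans x0).
Qed.

Lemma stoch_prod (R : realType) (I A B : finType) (P : A -> B -> R) :
  stoch P ->
  stoch (fun (a : {ffun I -> A}) (b : {ffun I -> B}) => \prod_i P (a i) (b i)).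
Proof.
move=> [P0 P1]; split=> [a b|a]; first by apply: prodr_ge0.
by apply: (@product_law_total R I B (fun i => P (a i))).
Qed.

Lemma rho_le_rhomax (R : realType) (U V : finType) (rho : U -> V -> R) u v :
  rho u v <= rhomax rho.
Proof. by rewrite /rhomax (le_bigmax _ (fun uv => rho uv.1 uv.2) (u, v)). Qed.

Lemma rhomax_ge0 (R : realType) (U V : finType) (rho : U -> V -> R) :
  0 <= rhomax rho.
Proof. exact: bigmax_ge_id. Qed.

Lemma emp_dist_blocks (R : realType) (U : finType) (m l : nat)
    (u : 'I_(m * l) -> U) (a : {ffun 'I_l -> U}) :
  (0 < l)%N ->
  emp_dist R u a =
    \sum_(j < m | [ffun k => u (block_index j k)] == a) m%:R^-1.
Proof.
move=> l0; rewrite /emp_dist.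
have -> : l%:R / (m * l)%:R = m%:R^-1 :> R.
  by rewrite natrM invfM mulrCA divff ?mulr1 // pnatr_eq0 -lt0n.
rewrite sumr_const -[RHS]mulr_natr; congr (_ * _%:R).
(* The index type depends on the quotient, which is generalized before it is replaced by [m]. *)
move: (m * l %/ l)%N (mulnK m l0) => M ->.
apply: eq_card => j; transitivity ([ffun k => u (block_index j k)] == a) => //.
apply/idP/eqP.
  move=> /set_mem /= /'forall_'forall_implyP H.
  apply/ffunP => k; rewrite ffunE; apply/eqP.
  by apply: (H k (block_index j k)).
move=> <-; apply: mem_set => /=; apply/'forall_'forall_implyP => k k2 /eqP kE.
by rewrite ffunE; apply/eqP; congr u; apply/val_inj.
Qed.

(** * Information and distortion of a random block *)

Section Blocks.
Variables (R : realType) (U X Y W V : finType) (m l d sd : nat).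
Variables (PY : X -> Y -> R) (PW : U -> W -> R) (rho : U -> V -> R).
Hypotheses (sPY : stoch PY) (sPW : stoch PW).
Hypotheses (m0 : (0 < m)%N) (l0 : (0 < l)%N).
Variables (u : 'I_(m * l) -> U) (x : 'I_(m * l) -> X).
Variables (f' : nat -> W -> Y -> 'I_sd -> V) (g' : nat -> W -> Y -> 'I_sd -> 'I_sd).
Variables (zd1 : 'I_sd) (vfix : 'I_(m * l) -> V).

Local Notation Ul := {ffun 'I_l -> U}.
Local Notation Wl := {ffun 'I_l -> W}.
Local Notation Yl := {ffun 'I_l -> Y}.
Local Notation A := ('I_sd * Yl)%type.

(** A deterministic source makes the channel inputs deterministic as well, so the pairs (W_i, Y_i)
    are independent with these laws. *)
Let kappa (i : 'I_(m * l)) (c : W * Y) : R := PW (u i) c.1 * PY (x i) c.2.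

Let kappa1 i : \sum_c kappa i c = 1.
Proof.
rewrite -(pair_bigA _ (fun w y => PW (u i) w * PY (x i) y)) /=.
by under eq_bigr do rewrite -mulr_sumr sPY.2 mulr1; exact: sPW.2.
Qed.

Let kappa_ge0 i c : 0 <= kappa i c.
Proof. by rewrite mulr_ge0 // ?sPW.1 ?sPY.1. Qed.

Let state (s : {ffun 'I_(m * l) -> W * Y}) (j : 'I_m) : 'I_sd :=
  dec_state l [ffun i => (s i).1] [ffun i => (s i).2] g' zd1 (j * l).

Definition state_law (j : 'I_m) (z : 'I_sd) : R :=
  \sum_(s : {ffun 'I_(m * l) -> W * Y}) (\prod_i kappa i (s i)) *
    (state s j == z)%:R.

Lemma state_law_ge0 j z : 0 <= state_law j z.
Proof. by apply: sumr_ge0 => s _; rewrite mulr_ge0 ?ler0n // prodr_ge0. Qed.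

Lemma state_law_total j : \sum_z state_law j z = 1.
Proof.
rewrite exchange_big /= -[RHS](product_law_total kappa1); apply: eq_bigr => s _.
rewrite -mulr_sumr (bigD1 (state s j)) //= eqxx [X in _ + X]big1 ?addr0 ?mulr1 // => z.
by rewrite eq_sym => /negPf ->.
Qed.

Let bu (j : 'I_m) : Ul := [ffun k => u (block_index j k)].

(** The law of A in block [j], a product because the initial state is a function of earlier noise
    only. *)
Definition block_law (j : 'I_m) (a : A) : R :=
  state_law j a.1 * \prod_k PY (x (block_index j k)) (a.2 k).

Let KW (uu : Ul) (w : Wl) : R := \prod_k PW (uu k) (w k).

Lemma block_law_sum j (F : 'I_sd -> R) (G : Yl -> R) :
  \sum_a block_law j a * (F a.1 * G a.2) =
  (\sum_z state_law j z * F z) *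
    (\sum_(y : Yl) (\prod_k PY (x (block_index j k)) (y k)) * G y).
Proof.
rewrite big_distrlr /= pair_big /=; apply: eq_bigr => -[z y] _ /=.
by rewrite /block_law mulrACA.
Qed.

Lemma block_law_stoch : stoch block_law.
Proof.
split=> [j a|j].
  by rewrite mulr_ge0 ?state_law_ge0 // prodr_ge0 // => k _; rewrite sPY.1.
have := block_law_sum j (fun=> 1) (fun=> 1).
under eq_bigr do rewrite !mulr1; move=> ->.
under eq_bigr do rewrite mulr1; rewrite state_law_total mul1r.
under eq_bigr do rewrite mulr1.
by apply: (product_law_total (kappa := fun k => PY (x (block_index j k)))) => k;
  rewrite sPY.2.
Qed.

(* The decoder state at the start of a block depends on the past only, hence it is
   independent of what happens inside the block. *)
Lemma expect_block j (F : 'I_sd -> Wl -> Yl -> R) :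
  \sum_(s : {ffun 'I_(m * l) -> W * Y}) (\prod_i kappa i (s i)) *
    F (state s j) [ffun k => (s (block_index j k)).1]
                  [ffun k => (s (block_index j k)).2] =
  \sum_a \sum_(w : Wl) block_law j a * KW (bu j) w * F a.1 w a.2.
Proof.
pose B := [set block_index j k | k : 'I_l].
pose H z (b : {ffun 'I_l -> W * Y}) :=
  F z [ffun k => (b k).1] [ffun k => (b k).2].
(* Splitting on the value of the state turns the integrand into a function of the past times a
   function of the block. *)
transitivity (\sum_z \sum_(s : {ffun 'I_(m * l) -> W * Y})
  (\prod_i kappa i (s i)) *
    ((state s j == z)%:R * H z [ffun k => s (block_index j k)])).
  rewrite exchange_big /=; apply: eq_bigr => s _.
  rewrite -mulr_sumr (bigD1 (state s j)) //= eqxx mul1r [X in _ + X]big1 ?addr0.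
    by congr (_ * F _ _ _); apply/ffunP => k; rewrite !ffunE.
  by move=> z; rewrite eq_sym => /negPf ->; rewrite mul0r.
rewrite -(pair_bigA _ (fun z y => \sum_(w : Wl) block_law j (z, y) * KW (bu j) w * F z w y)).
apply: eq_bigr => z _ /=.
rewrite (product_law_indep kappa1 (B := B) (f := fun s => (state s j == z)%:R)
  (g := fun s => H z [ffun k => s (block_index j k)])); first last.
- move=> s s' ss; congr H; apply/ffunP => k; rewrite !ffunE; apply: ss.
  exact: imset_f.
- move=> s s' ss; congr (_ == _)%:R; apply: eq_dec_state => i ij.
  suff iB : i \notin B by rewrite !ffunE ss.
  apply/imsetP => -[k _ ik]; move: ij; rewrite ik /= ltnNge.
  by rewrite leq_addr.
rewrite -/(state_law j z) (product_law_marginal kappa1) => [|k k']; last first.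
  by case/block_index_inj.
rewrite exchange_big sum_ffun_pair mulr_sumr; apply: eq_bigr => b _ /=.
have -> : KW (bu j) [ffun k => (b k).1] =
    \prod_k PW (u (block_index j k)) (b k).1.
  by apply: eq_bigr => k _; rewrite !ffunE.
have -> : block_law j (z, [ffun k => (b k).2]) =
    state_law j z * \prod_k PY (x (block_index j k)) (b k).2.
  by congr (_ * _); apply: eq_bigr => k _; rewrite !ffunE.
by rewrite /kappa big_split /H /=; ring.
Qed.

(** The output marginal under the empirical input law; [D i] is the divergence from it at time
    [i]. *)
Let Pbar (y : Y) : R := #|'I_(m * l)|%:R^-1 * \sum_i PY (x i) y.

Let D (i : 'I_(m * l)) : R := \sum_y PY (x i) y * log2 (PY (x i) y / Pbar y).

Let Pbar_ge0 y : 0 <= Pbar y.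
Proof. by rewrite mulr_ge0 ?invr_ge0 ?ler0n // sumr_ge0 // => i _; rewrite sPY.1. Qed.

Let Pbar_gt0 i y : 0 < PY (x i) y -> 0 < Pbar y.
Proof.
move=> p; rewrite mulr_gt0 ?invr_gt0 ?ltr0n ?card_ord ?muln_gt0 ?m0 //.
by rewrite (bigD1 i) //= ltr_wpDr // sumr_ge0 // => i' _; rewrite sPY.1.
Qed.

Let Pbar_total : \sum_y Pbar y = 1.
Proof.
rewrite -mulr_sumr exchange_big /=; under eq_bigr do rewrite sPY.2.
by rewrite sumr_const mulVf // pnatr_eq0 card_ord -lt0n muln_gt0 m0.
Qed.

Let sd0 : 0 < sd%:R :> R.
Proof. by rewrite ltr0n (leq_ltn_trans _ (ltn_ord zd1)). Qed.

Let ref_law (a : A) : R := sd%:R^-1 * \prod_k Pbar (a.2 k).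

(** The likelihood ratio is [sd] times the state probability times the letter ratios [c k]. The
    state probability is at most 1, and the logarithms of the letter ratios average to the [D] of
    their times. *)
Lemma block_divergence_le j :
  \sum_a block_law j a * log2 (block_law j a / ref_law a) <=
    log2 sd%:R + \sum_k D (block_index j k).
Proof.
pose c k y := PY (x (block_index j k)) y / Pbar y.
have bl0 := block_law_stoch.1.
apply: (@le_trans _ _ (\sum_a block_law j a *
    (log2 sd%:R + \sum_k log2 (c k (a.2 k))))).
  apply: ler_sum => -[z y] _; have [->|bn] := eqVneq (block_law j (z, y)) 0.
    by rewrite !mul0r.
  have bp : 0 < block_law j (z, y) by rewrite lt0r bn bl0.
  rewrite ler_pM2l //=.
  move: bn; rewrite mulf_eq0 negb_or /= => /andP[zn /prodf_neq0 yn].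
  have PYp k : 0 < PY (x (block_index j k)) (y k) by rewrite lt0r yn // sPY.1.
  have Pp k : 0 < Pbar (y k) by apply: Pbar_gt0 (PYp k).
  have cp k : 0 < c k (y k) by rewrite divr_gt0.
  have refp : 0 < ref_law (z, y) by rewrite mulr_gt0 ?invr_gt0 // prodr_gt0.
  rewrite -log2_prod // -log2M // ?prodr_gt0 //; apply: ler_log2.
    by rewrite divr_gt0.
  rewrite big_split /= prodfV invfM invrK mulrACA ler_wpM2r //.
    by rewrite mulr_ge0 ?invr_ge0 ?prodr_ge0 // => k _; rewrite ltW.
  rewrite ler_piMl ?(ltW sd0) // -(state_law_total j) (bigD1 z) //= lerDl.
  by rewrite sumr_ge0 // => z' _; rewrite state_law_ge0.
under eq_bigr do rewrite mulrDr.
rewrite big_split /= -mulr_suml block_law_stoch.2 mul1r lerD2l.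
under eq_bigr do rewrite -[X in _ * X]mul1r.
rewrite (block_law_sum j (fun=> 1) (fun y => \sum_k log2 (c k (y k)))) /=.
under eq_bigr do rewrite mulr1; rewrite state_law_total mul1r.
under eq_bigr do rewrite mulr_sumr.
rewrite exchange_big /=; apply: ler_sum => k _.
by rewrite (@product_law_proj _ _ _ (fun k => PY (x (block_index j k)))
  (fun k => sPY.2 (x (block_index j k))) k (fun y => log2 (c k y))).
Qed.

(** The mean over blocks of the summed divergences is [l] times their mean over all times, which the
    capacity bounds. *)
Lemma block_condmi_le (phi : X -> R) (Gam : R) :
  (m * l)%:R^-1 * \sum_i phi (x i) <= Gam ->
  condmi (fun uu a w => (\sum_(j | bu j == uu) m%:R^-1 * block_law j a) * KW uu w)
    <= l%:R * capacity PY phi Gam + log2 sd%:R.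
Proof.
move=> cost.
have mR : 0 < m%:R :> R by rewrite ltr0n.
apply: (le_trans (condmi_mixture_le (pi := fun=> m%:R^-1) bu (r := ref_law)
  _ block_law_stoch (stoch_prod _ sPW) _ _ _)).
- split=> [_|]; first by rewrite invr_ge0 ltW.
  by rewrite sumr_const card_ord -[LHS]mulr_natr mulVf // gt_eqF.
- by move=> a; rewrite mulr_ge0 ?invr_ge0 ?(ltW sd0) // prodr_ge0.
- rewrite -(pair_bigA _ (fun (z : 'I_sd) (y : Yl) => sd%:R^-1 * \prod_k Pbar (y k))) /=.
  under eq_bigr do rewrite -mulr_sumr
    (product_law_total (kappa := fun=> Pbar)) // mulr1.
  by rewrite sumr_const card_ord -[leLHS]mulr_natr mulVf // gt_eqF.
(* Absolute continuity: an output letter of zero average probability has probability zero at every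
   time. *)
- move=> j [z y] /eqP; rewrite mulf_eq0 invr_eq0 gt_eqF //= => /prodf_eq0[k _ /eqP yk].
  suff z0 : PY (x (block_index j k)) (y k) = 0.
    by rewrite /block_law /= (bigD1 k) //= z0 mul0r mulr0.
  apply/eqP; have := sPY.1 (x (block_index j k)) (y k).
  by rewrite le_eqVlt => /orP[/eqP <-//|/Pbar_gt0]; rewrite yk ltxx.
rewrite -mulr_sumr.
apply: (@le_trans _ _ (m%:R^-1 * \sum_j (log2 sd%:R + \sum_k D (block_index j k)))).
  by rewrite ler_pM2l ?invr_gt0 // ler_sum // => j _; exact: block_divergence_le.
rewrite big_split /= sumr_const card_ord -sum_blocks mulrDr -[log2 _ *+ m]mulr_natl.
rewrite mulKf ?gt_eqF // addrC lerD2r.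
have lR : 0 < l%:R :> R by rewrite ltr0n.
have := @mean_divergence_le_capacity R X Y 'I_(m * l) PY phi Gam x sPY.
rewrite card_ord muln_gt0 m0 l0 => /(_ isT cost).
rewrite -(ler_pM2l lR); apply: le_trans; rewrite /D /Pbar card_ord natrM invfM.
by rewrite mulrA mulrCA divff ?gt_eqF // mulr1.
Qed.

(** The map G for the large alphabet. Symbols not emitted within the block are filled with the fixed
    symbols of the first block. *)
Definition block_decoder (a : A) (w : Wl) : {ffun 'I_l -> V} :=
  [ffun k => dec_out l d w a.2 f' g' a.1
    (fun k => vfix (block_index (Ordinal m0) k)) k].

(** On each noise realization the block decoder agrees with the true one wherever [k + d < l]; each
    other position costs at most [rhomax rho]. *)
Lemma block_distortion_le :
  (forall a b, 0 <= rho a b) ->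
  \sum_uu \sum_a \sum_w (\sum_(j | bu j == uu) m%:R^-1 * block_law j a) *
     KW uu w * rho_l rho uu (block_decoder a w) <=
  l%:R * (\sum_(w : {ffun 'I_(m * l) -> W}) \sum_(y : {ffun 'I_(m * l) -> Y})
    (\prod_i (PW (u i) (w i) * PY (x i) (y i))) *
    ((m * l)%:R^-1 * \sum_i rho (u i) (dec_out l d w y f' g' zd1 vfix i)))
  + d%:R * rhomax rho.
Proof.
move=> rho0.
have mR : 0 < m%:R :> R by rewrite ltr0n.
have lR : 0 < l%:R :> R by rewrite ltr0n.
pose mu (s : {ffun 'I_(m * l) -> W * Y}) := \prod_i kappa i (s i).
have mu0 s : 0 <= mu s by apply: prodr_ge0.
pose Vs (s : {ffun 'I_(m * l) -> W * Y}) i :=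
  dec_out l d [ffun i => (s i).1] [ffun i => (s i).2] f' g' zd1 vfix i.
have -> : \sum_uu \sum_a \sum_w (\sum_(j | bu j == uu) m%:R^-1 * block_law j a) *
     KW uu w * rho_l rho uu (block_decoder a w) =
  m%:R^-1 * \sum_s mu s * \sum_j rho_l rho (bu j)
    (block_decoder (state s j, [ffun k => (s (block_index j k)).2])
      [ffun k => (s (block_index j k)).1]).
  under [in RHS]eq_bigr do rewrite mulr_sumr.
  rewrite [in RHS]exchange_big mulr_sumr /=.
  under [in RHS]eq_bigr => j _ do rewrite
    (expect_block j (fun z w y => rho_l rho (bu j) (block_decoder (z, y) w))).
  rewrite exchange_big /= [RHS](eq_bigr (fun j => \sum_a m%:R^-1 * \sum_w
    block_law j a * KW (bu j) w * rho_l rho (bu j) (block_decoder a w)));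
    last by move=> j _; rewrite mulr_sumr; apply: eq_bigr => -[].
  rewrite [RHS]exchange_big /=; apply: eq_bigr => a _.
  under eq_bigr do under eq_bigr do rewrite -mulrA.
  under eq_bigr do rewrite -mulr_sumr.
  rewrite (sum_fiber bu _
    (fun uu => \sum_w KW uu w * rho_l rho uu (block_decoder a w))).
  apply: eq_bigr => j _; rewrite -mulrA mulr_sumr; congr (_ * _).
  by apply: eq_bigr => w _; rewrite mulrA.
have -> : l%:R * (\sum_(w : {ffun 'I_(m * l) -> W}) \sum_(y : {ffun 'I_(m * l) -> Y})
    (\prod_i (PW (u i) (w i) * PY (x i) (y i))) *
    ((m * l)%:R^-1 * \sum_i rho (u i) (dec_out l d w y f' g' zd1 vfix i))) =
  m%:R^-1 * \sum_s mu s * \sum_j \sum_k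
     rho (u (block_index j k)) (Vs s (block_index j k)).
  rewrite sum_ffun_pair !mulr_sumr; apply: eq_bigr => s _.
  rewrite -(sum_blocks (fun i => rho (u i) (Vs s i))) natrM invfM.
  have -> : \prod_i (PW (u i) ([ffun i => (s i).1] i) *
      PY (x i) ([ffun i => (s i).2] i)) = mu s.
    by apply: eq_bigr => i _; rewrite !ffunE.
  by rewrite /Vs; field; rewrite !gt_eqF.
(* The penalty is written as an average over noise and blocks too, so that the comparison is
   termwise. *)
have -> : d%:R * rhomax rho = m%:R^-1 * \sum_s mu s * \sum_(j < m) d%:R * rhomax rho.
  rewrite -mulr_suml (product_law_total kappa1) mul1r sumr_const card_ord.
  by rewrite -[_ * _ *+ m]mulr_natl mulKf ?gt_eqF.
rewrite -mulrDr ler_pM2l ?invr_gt0 // -big_split /=.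
apply: ler_sum => s _; rewrite -mulrDr; apply: ler_wpM2l => //.
rewrite -big_split /=; apply: ler_sum => j _.
(* There are [l - (l - d)] late positions; with truncated subtraction this is at most [d] even when
   [d] exceeds [l]. *)
have late : \sum_(k < l) (if (k + d < l)%N then 0 else rhomax rho)
    <= d%:R * rhomax rho.
  rewrite -(big_mkord predT (fun k => if (k + d < l)%N then 0 else rhomax rho)).
  rewrite (big_cat_nat (n := (l - d)%N)) ?leq_subr //=.
  rewrite [X in X + _]big_nat big1 ?add0r => [|k /andP[_]]; last first.
    by rewrite ltn_subRL addnC => ->.
  apply: (@le_trans _ _ (\sum_((l - d)%N <= k < l) rhomax rho)).
    by apply: ler_sum => k _; case: ifP; rewrite ?rhomax_ge0.
  rewrite sumr_const_nat -[leLHS]mulr_natl ler_wpM2r ?rhomax_ge0 // ler_nat.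
  by rewrite leq_subLR addnC -leq_subLR.
apply: le_trans (lerD (lexx _) late); rewrite -big_split /=.
apply: ler_sum => k _; rewrite /bu !ffunE.
case: ifP => kd; last first.
  by rewrite -[leLHS]add0r lerD // rho_le_rhomax.
rewrite addr0 /Vs (dec_out_block _ _ _ _ _ _
  (fun k => vfix (block_index (Ordinal m0) k))) //.
rewrite le_eqVlt; apply/orP; left; apply/eqP; congr rho.
by apply: eq_dec_out => i; rewrite !ffunE.
Qed.
End Blocks.

(** * From the block law to an admissible test channel *)

Lemma DWZ_le (R : realType) (U X Y W V : finType) (m l d sd : nat)
    (PY : X -> Y -> R) (PW : U -> W -> R) (rho : U -> V -> R) (phi : X -> R)
    (Gam Rt : R) (u : 'I_(m * l) -> U) (x : 'I_(m * l) -> X)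
    (f' : nat -> W -> Y -> 'I_sd -> V) (g' : nat -> W -> Y -> 'I_sd -> 'I_sd)
    (zd1 : 'I_sd) (vfix : 'I_(m * l) -> V) :
  stoch PY -> stoch PW -> (0 < m)%N -> (0 < l)%N ->
  (forall a b, 0 <= rho a b) ->
  (m * l)%:R^-1 * \sum_i phi (x i) <= Gam ->
  capacity PY phi Gam + log2 sd%:R / l%:R <= Rt ->
  (DWZ (@emp_dist R U l _ u) PW rho Rt <=
    (\sum_(w : {ffun 'I_(m * l) -> W}) \sum_(y : {ffun 'I_(m * l) -> Y})
      (\prod_i (PW (u i) (w i) * PY (x i) (y i))) *
      ((m * l)%:R^-1 * \sum_i rho (u i) (dec_out l d w y f' g' zd1 vfix i))
     + rhomax rho * d%:R / l%:R)%:E)%E.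
Proof.
move=> sPY sPW m0 l0 rho0 cost rate.
have lR : 0 < l%:R :> R by rewrite ltr0n.
pose p := @emp_dist R U l _ u.
pose bu (j : 'I_m) : {ffun 'I_l -> U} := [ffun k => u (block_index j k)].
pose bl := block_law PY PW u x g' zd1.
have bls : stoch bl by exact: block_law_stoch.
pose q uu a := \sum_(j | bu j == uu) m%:R^-1 * bl j a.
have q0 uu a : 0 <= q uu a.
  by apply: sumr_ge0 => j _; rewrite mulr_ge0 ?invr_ge0 ?ler0n ?bls.1.
have qp uu : \sum_a q uu a = p uu.
  rewrite /p emp_dist_blocks // exchange_big /=; apply: eq_bigr => j _.
  by rewrite -mulr_sumr bls.2 mulr1.
pose KW (uu : {ffun 'I_l -> U}) (w : {ffun 'I_l -> W}) := \prod_k PW (uu k) (w k).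
pose G := block_decoder d m0 f' g' vfix.
pose delta a := \sum_uu \sum_w q uu a * KW uu w * rho_l rho uu (G a w).
(* A default letter for the reduction; it exists since the block law sums to 1. *)
have [a0 _] : exists a, bl (Ordinal m0) a != 0.
  apply/existsP; rewrite -negb_forall; apply/negP => /forallP bl0.
  have := bls.2 (Ordinal m0); rewrite big1 => [|a _]; last exact/eqP.
  by move/esym/eqP; rewrite oner_eq0.
have NE : (#|U| ^ l + 1)%N = (#|{: {ffun 'I_l -> U}}| + 1)%N.
  by rewrite card_ffun card_ord.
have [a qa|r [t [t0 tq td tI]]] := aux_reduction (delta := delta) a0 KW NE q0.
  by apply: big1 => uu _; apply: big1 => w _; rewrite qa !mul0r.
have N0 : (0 < #|U| ^ l + 1)%N by rewrite addn1.
(* The conditional law of the reduced letter. Where [p uu] is 0 a point mass keeps the row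
   stochastic; [pQ] holds there because the whole row of [q] vanishes. *)
pose Q uu i : R := if p uu == 0 then (i == Ordinal N0)%:R else t i * q uu (r i) / p uu.
have pQ uu i : p uu * Q uu i = t i * q uu (r i).
  rewrite /Q; case: eqVneq => [p0|pn]; last by rewrite mulrC divfK.
  move: (qp uu); rewrite p0 mul0r => /eqP; rewrite psumr_eq0 // => /allP /(_ (r i)).
  by rewrite mem_index_enum => /(_ isT) /eqP ->; rewrite mulr0.
have p0 uu : 0 <= p uu by rewrite -qp sumr_ge0.
have sQ : stoch Q.
  split=> [uu i|uu]; rewrite /Q; case: eqVneq => [_|pn] //.
    by rewrite divr_ge0 // mulr_ge0.
  - rewrite (bigD1 (Ordinal N0)) //= ?eqxx big1 ?addr0 // => i /negPf ->.
    by [].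
  - by rewrite -mulr_suml tq qp divff.
(* The right-hand side is itself a distortion level D; it remains to see that its rate is at most
   [Rt]. *)
apply: ereal_inf_lbound; eexists; last reflexivity => /=.
apply: (@le_trans _ _ (wz_condmi p Q PW / l%:R)%:E).
  apply: ereal_inf_lbound; exists Q => //; split=> //.
  exists (fun i w => G (r i) w).
  have -> : wz_dist p Q PW rho (fun i w => G (r i) w) = \sum_a delta a.
    rewrite -td /wz_dist exchange_big /=; apply: eq_bigr => i _.
    rewrite mulr_sumr; apply: eq_bigr => uu _.
    rewrite mulr_sumr; apply: eq_bigr => w _.
    by rewrite /wz_joint pQ -!mulrA.
  rewrite mulrDr mulrCA divff ?gt_eqF // mulr1 [rhomax _ * _]mulrC.
  rewrite exchange_big /=; exact: block_distortion_le.
rewrite lee_fin; apply: le_trans rate; rewrite ler_pdivrMr //.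
rewrite mulrDl divfK ?gt_eqF // [capacity _ _ _ * _]mulrC.
apply: le_trans (block_condmi_le sPY sPW m0 l0 u g' zd1 cost).
apply: le_trans tI; rewrite le_eqVlt; apply/orP; left; apply/eqP.
rewrite /wz_condmi -/(condmi (wz_joint p Q PW)); congr condmi.
by apply/funext => uu; apply/funext => i; apply/funext => w; rewrite /wz_joint pQ.
Qed.

(** * The bound for finite-state encoders and decoders *)

Unset Implicit Arguments.
Local Open Scope classical_set_scope.
Local Open Scope ring_scope.

Theorem theorem2 (R : realType) (U X Y W V : finType) (PY : X -> Y -> R)
  (l se : nat) :
  stoch PY -> (0 < l)%N ->
  exists eps : nat -> R,
    ((fun n : nat => Num.sqrt (n%:R) * eps n) @ \oo --> (0 : R)) /\
    forall (n : nat) (PW : U -> W -> R) (rho : U -> V -> R) (phi : X -> R)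
      (Gam : R) (d sd : nat) (u : 'I_n -> U)
      (f : nat -> U -> 'I_se -> X) (g : nat -> U -> 'I_se -> 'I_se)
      (ze1 : 'I_se)
      (f' : nat -> W -> Y -> 'I_sd -> V) (g' : nat -> W -> Y -> 'I_sd -> 'I_sd)
      (zd1 : 'I_sd) (vfix : 'I_n -> V),
      (0 < n)%N -> (l %| n)%N -> (0 < d)%N ->
      stoch PW -> (forall a b, 0 <= rho a b) -> (forall x, 0 <= phi x) ->
      0 <= Gam ->
      n%:R^-1 * \sum_(i < n) phi (@enc_out U X n l _ u f g ze1 i) <= Gam ->
      ((avg_exp_dist l PY PW rho d u f g ze1 f' g' zd1 vfix)%:E >=
        @DWZ R U W V l (@emp_dist R U l n u) PW rho
          (capacity PY phi Gam + log2 (sd%:R) / l%:R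
           + se%:R * (#|U|%:R ^+ l) * log2 (#|Y|%:R) / Num.sqrt (n%:R)
           + eps n)
        - (rhomax rho * d%:R / l%:R)%:E)%E.
Proof.
move=> sPY l0; exists (fun=> 0); split.
  by under eq_fun do rewrite mulr0; exact: cvg_cst.
move=> n PW rho phi Gam d sd u f g ze1 f' g' zd1 vfix n0 /dvdnP[m nE] _ sPW rho0 _ _.
subst n => cost; rewrite leeBlDr // -EFinD.
have m0 : (0 < m)%N by move: n0; rewrite muln_gt0 => /andP[].
apply: (@DWZ_le R U X Y W V m l d sd PY PW rho phi Gam _ u
  (enc_out l u f g ze1)) => //.
(* The additional rate term is nonnegative because the output alphabet is nonempty: a row of [PY]
   sums to 1. *)
rewrite addr0 lerDl divr_ge0 ?sqrtr_ge0 // mulr_ge0 //.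
apply: log2_ge0; rewrite ler1n lt0n; apply/eqP => Y0.
have := sPY.2 (enc_out l u f g ze1 (Ordinal n0)).
rewrite big1 => [/esym/eqP|y _]; first by rewrite oner_eq0.
by have := max_card (pred1 y); rewrite card1 Y0.
Qed.
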